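(* Let $G$ be a $V$-generic filter for the forcing $P(\omega\times\omega)/\mathrm{fin}\otimes\mathrm{fin}$. Then in $V[G]$, $G$ is an ultrafilter on $\omega\times\omega$ and: (1) $\mathrm{fin}\otimes\mathrm{fin}\subseteq G^*$; (2) $G$ has the $\mathrm{fin}\otimes\mathrm{fin}$-pseudo intersection property; (3) $G$ is $2$-rapid; (4) $(G\cdot G,\supseteq)\equiv_T(G,\supseteq)$.
   Context: $\mathrm{fin}\otimes\mathrm{fin}$ is the ideal on $\omega\times\omega$ of all $A$ such that $\{n:(A)_n\text{ is infinite}\}$ is finite, where $(A)_n=\{m:(n,m)\in A\}$. The forcing $P(\omega\times\omega)/\mathrm{fin}\otimes\mathrm{fin}$ consists of the subsets of $\omega\times\omega$ not in $\mathrm{fin}\otimes\mathrm{fin}$, ordered by $A\le B$ iff $A\setminus B\in\mathrm{fin}\otimes\mathrm{fin}$; it is $\sigma$-closed and adds no reals. $G^*=P(\omega\times\omega)\setminus G$. For an ideal $I\subseteq U^*$, an ultrafilter $U$ has the $I$-pseudo intersection property if for every sequence $\langle A_n\rangle_{n<\omega}\subseteq U$ there is $A\in U$ with $A\setminus A_n\in I$ for all $n$. An ultrafilter $W$ on $\omega$ is rapid if for every increasing $f:\omega\to\omega$ there is $X\in W$ with $|X\cap f(n)|\le n$ for all $n$. An ultrafilter $U$ on $\omega\times\omega$ with $\mathrm{fin}\otimes\mathrm{fin}\subseteq U^*$ is $2$-rapid if $\pi_*(U)=\{X\subseteq\omega:\pi^{-1}X\in U\}$ is rapid, $\pi$ the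 projection to the first coordinate. $U\cdot U$ is the filter on $(\omega\times\omega)^2$ with $A\in U\cdot U$ iff $\{x:\{y:(x,y)\in A\}\in U\}\in U$. $P\le_TQ$ means there is $f:Q\to P$ sending cofinal sets to cofinal sets; $\equiv_T$ is two-way $\le_T$. *)

(* Defs.v *)
From mathcomp Require Import all_boot.
From mathcomp Require Import boolp classical_sets functions cardinality.

Set Implicit Arguments.
Unset Strict Implicit.
Unset Printing Implicit Defensive.

(** [V] is read as the universe of well-founded trees branching over small
    types (Aczel's sets); the names of [V[G]] are such trees whose branches
    carry conditions.  No filter is [V]-generic in [V] itself, so "if [G] is
    [V]-generic then [V[G]] satisfies phi(G)" has its usual meaning: every
    condition forces phi of the canonical name of [G].  The forcing relation
    is the usual one defined in [V] by recursion on names and formulas. *)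

Record forcing_notion := ForcingNotion {
  condition :> Type;
  fle : condition -> condition -> Prop;
  fone : condition;
  fle_refl : forall p, fle p p;
  fle_trans : forall p q r, fle p q -> fle q r -> fle p r;
  fle_one : forall p, fle p fone
}.

Arguments fle {f}.
Arguments fone {f}.

(* [Name x c] is the name {(x i, c i) : i in I}. *)
Inductive name (P : forcing_notion) : Type :=
  Name (I : Type) (x : I -> name P) (c : I -> P).

Arguments Name {P I}.

(* A sentence of the forcing language is identified with the set of the
   conditions forcing it.  The atomic sentences below are closed downwards and
   under [dense_below], and the connectives preserve this.  A [class] is a
   formula in one variable, with names as parameters: it plays the role of a
   class term {x | C x} of [V[G]]. *)
Definition sentence (P : forcing_notion) := P -> Prop.
Definition class (P : forcing_notion) := name P -> sentence P.

Definition forces (P : forcing_notion) (p : P) (phi : sentence P) : Prop :=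
  phi p.

Definition dense_below (P : forcing_notion) (D : P -> Prop) (p : P) : Prop :=
  forall q, fle q p -> exists2 r, fle r q & D r.

(* p forces a = b iff every q <= p below the condition of an element of one
   of the two names forces that element to belong to the other name; the
   membership clause is [fmem] below, inlined to make the recursion
   structural. *)
Fixpoint feq (P : forcing_notion) (a b : name P) {struct a} : sentence P :=
  fun p =>
    match a, b with
    | Name _ x c, Name _ y d =>
        (forall i q, fle q p -> fle q (c i) ->
           dense_below (fun r => exists2 j, fle r (d j) & feq (x i) (y j) r) q)
        /\
        (forall j q, fle q p -> fle q (d j) ->
           dense_below (fun r => exists2 i, fle r (c i) & feq (x i) (y j) r) q)
    end.

Definition fmem (P : forcing_notion) (a b : name P) : sentence P :=
  fun p =>
    match b with
    | Name _ y d =>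
        dense_below (fun r => exists2 j, fle r (d j) & feq a (y j) r) p
    end.

Section Connectives.
Context {P : forcing_notion}.
Implicit Types phi psi : sentence P.

Definition fnot phi : sentence P := fun p => forall q, fle q p -> ~ phi q.
Definition fand phi psi : sentence P := fun p => phi p /\ psi p.
Definition for_ phi psi : sentence P :=
  fun p => dense_below (fun q => phi q \/ psi q) p.
Definition fimp phi psi : sentence P :=
  fun p => forall q, fle q p -> phi q -> psi q.
Definition fiff phi psi : sentence P := fand (fimp phi psi) (fimp psi phi).
Definition fall (phi : class P) : sentence P := fun p => forall a, phi a p.
Definition fex (phi : class P) : sentence P :=
  fun p => dense_below (fun q => exists a, phi a q) p.

End Connectives.

Declare Scope forcing_scope.
Delimit Scope forcing_scope with F.
Bind Scope forcing_scope with sentence.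

Notation "p ⊩ phi" := (forces p phi%F) (at level 99, phi at level 200).
Notation "a ≈ b" := (feq a b) (at level 70, no associativity) : forcing_scope.
Notation "a ∈ b" := (fmem a b) (at level 70, no associativity) : forcing_scope.
Notation "¬ phi" := (fnot phi) (at level 75, right associativity)
  : forcing_scope.
Notation "phi ∧ psi" := (fand phi psi) (at level 80, right associativity)
  : forcing_scope.
Notation "phi ∨ psi" := (for_ phi psi) (at level 85, right associativity)
  : forcing_scope.
Notation "phi ⇒ psi" := (fimp phi psi)
  (at level 90, psi at level 200, right associativity) : forcing_scope.
Notation "phi ⇔ psi" := (fiff phi psi) (at level 95, no associativity)
  : forcing_scope.
Notation "∀ a , phi" := (fall (fun a => phi%F))
  (at level 200, a binder, right associativity) : forcing_scope.
Notation "∃ a , phi" := (fex (fun a => phi%F))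
  (at level 200, a binder, right associativity) : forcing_scope.

Local Open Scope forcing_scope.

Section CheckNames.
Context {P : forcing_notion}.

(* If each [x i] is the check name of a set, this is the check name of the
   set of these sets. *)
Definition check_set (I : Type) (x : I -> name P) : name P :=
  Name x (fun _ => fone).

Definition upair (a b : name P) : name P :=
  check_set (fun t : bool => if t then a else b).

(* Kuratowski pairs; [opair a b] names the pair of the values of any names
   [a] and [b]. *)
Definition opair (a b : name P) : name P := upair (upair a a) (upair a b).

(* a ∪ {a} *)
Definition succ_name (a : name P) : name P :=
  match a with
  | Name _ x c => Name (fun o => if o is Some i then x i else a)
                       (fun o => if o is Some i then c i else fone)
  end.

Definition empty_name : name P :=
  check_set (fun e : Empty_set => match e with end).

Definition num (n : nat) : name P := iter n succ_name empty_name.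

Definition omega : name P := check_set num.

Definition check_rel (A : set (nat * nat)) : name P :=
  check_set (fun z : {z : nat * nat | A z} =>
               opair (num (sval z).1) (num (sval z).2)).

End CheckNames.

Section Formulas.
Context {P : forcing_notion}.
Implicit Types (a b f s n m A B X Y : name P) (C D S T U W I : class P).

Definition elts a : class P := fun x => x ∈ a.

Definition subclass C D : sentence P := ∀ x, C x ⇒ D x.

Definition subset a b : sentence P := subclass (elts a) (elts b).

(* The class [C] is a set, and this set is an element of [U]. *)
Definition class_in C U : sentence P := ∃ X, U X ∧ (∀ x, x ∈ X ⇔ C x).

Definition emptyc : class P := fun x => ¬ (x ≈ x).

Definition capc C D : class P := fun x => C x ∧ D x.

Definition diffc C D : class P := fun x => C x ∧ ¬ D x.

Definition prodc C D : class P :=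
  fun z => ∃ x, ∃ y, C x ∧ D y ∧ z ≈ opair x y.

Definition is_fun f C D : sentence P :=
  subclass (elts f) (prodc C D) ∧
  (∀ x, C x ⇒ ∃ y, opair x y ∈ f ∧ (∀ y', opair x y' ∈ f ⇒ y' ≈ y)).

Definition is_inj f : sentence P :=
  ∀ x, ∀ x', ∀ y, opair x y ∈ f ∧ opair x' y ∈ f ⇒ x ≈ x'.

Definition is_onto f D : sentence P := ∀ y, D y ⇒ ∃ x, opair x y ∈ f.

Definition image f C : class P := fun y => ∃ x, C x ∧ opair x y ∈ f.

Definition is_finite C : sentence P :=
  ∃ n, n ∈ omega ∧
    (∃ f, is_fun f C (elts n) ∧ is_inj f ∧ is_onto f (elts n)).

Definition card_le C n : sentence P := ∃ f, is_fun f C (elts n) ∧ is_inj f.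

Definition omegac : class P := elts omega.

Definition omega2 : class P := prodc omegac omegac.

Definition section_at A n : class P := fun m => m ∈ omega ∧ opair n m ∈ A.

Definition fin_fin : class P := fun A =>
  subclass (elts A) omega2 ∧
  is_finite (fun n => n ∈ omega ∧ ¬ is_finite (section_at A n)).

Definition is_ultrafilter S U : sentence P :=
  (∀ X, U X ⇒ subclass (elts X) S) ∧
  class_in S U ∧
  ¬ class_in emptyc U ∧
  (∀ X, ∀ Y, U X ∧ U Y ⇒ class_in (capc (elts X) (elts Y)) U) ∧
  (∀ X, ∀ Y, U X ∧ subset X Y ∧ subclass (elts Y) S ⇒ U Y) ∧
  (∀ X, subclass (elts X) S ⇒ U X ∨ class_in (diffc S (elts X)) U).

(* U^* for [U] on [S]. *)
Definition dual S U : class P := fun A => subclass (elts A) S ∧ ¬ U A.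

Definition pseudo_intersection_property I U : sentence P :=
  ∀ s, is_fun s omegac U ⇒
    ∃ A, U A ∧
      (∀ n, ∀ X, opair n X ∈ s ⇒ class_in (diffc (elts A) (elts X)) I).

Definition is_increasing f : sentence P :=
  ∀ n, ∀ m, ∀ k, ∀ l, n ∈ m ∧ opair n k ∈ f ∧ opair m l ∈ f ⇒ k ∈ l.

Definition is_rapid W : sentence P :=
  is_ultrafilter omegac W ∧
  (∀ f, is_fun f omegac omegac ∧ is_increasing f ⇒
    ∃ X, W X ∧
      (∀ n, ∀ k, opair n k ∈ f ⇒ card_le (capc (elts X) (elts k)) n)).

Definition proj_preimage X : class P :=
  fun z => ∃ n, ∃ m, n ∈ omega ∧ m ∈ omega ∧ z ≈ opair n m ∧ n ∈ X.

Definition proj_ultrafilter U : class P := fun X =>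
  subclass (elts X) omegac ∧ class_in (proj_preimage X) U.

Definition is_2rapid U : sentence P :=
  is_ultrafilter omega2 U ∧ subclass fin_fin (dual omega2 U) ∧
  is_rapid (proj_ultrafilter U).

(* U . U for [U] on [S]. *)
Definition fubini_square S U : class P := fun A =>
  subclass (elts A) (prodc S S) ∧
  class_in (fun x => S x ∧ class_in (fun y => S y ∧ opair x y ∈ A) U) U.

Definition supset a b : sentence P := subset b a.

Definition is_cofinal C (le : name P -> class P) D : sentence P :=
  subclass D C ∧ (∀ x, C x ⇒ ∃ y, D y ∧ le x y).

(* (C, leC) <=_T (D, leD) *)
Definition tukey_le C (leC : name P -> class P) D (leD : name P -> class P)
    : sentence P :=
  ∃ f, is_fun f D C ∧
    (∀ X, is_cofinal D leD (elts X) ⇒ is_cofinal C leC (image f (elts X))).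

Definition tukey_equiv C leC D leD : sentence P :=
  tukey_le C leC D leD ∧ tukey_le D leD C leC.

End Formulas.

Section FinFinForcing.
Local Open Scope classical_set_scope.

Definition ground_fin_fin (A : set (nat * nat)) : Prop :=
  finite_set [set n | ~ finite_set [set m | A (n, m)]].

Definition finfin_cond := {A : set (nat * nat) | ~ ground_fin_fin A}.

Definition finfin_le (A B : finfin_cond) : Prop :=
  ground_fin_fin (sval A `\` sval B).

Lemma ground_fin_finW (A B : set (nat * nat)) :
  A `<=` B -> ground_fin_fin B -> ground_fin_fin A.
Proof.
move=> AB; apply: sub_finite_set => n /= nA nB; apply: nA.
by apply: sub_finite_set nB => m /=; apply: AB.
Qed.

Lemma ground_fin_finU (A B : set (nat * nat)) :
  ground_fin_fin A -> ground_fin_fin B -> ground_fin_fin (A `|` B).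
Proof.
move=> fA fB.
have : finite_set ([set n | ~ finite_set [set m | A (n, m)]] `|`
                   [set n | ~ finite_set [set m | B (n, m)]]).
  by rewrite finite_setU.
apply: sub_finite_set => n /= nAB.
have [a|na] := pselect (finite_set [set m | A (n, m)]); last by left.
have [b|nb] := pselect (finite_set [set m | B (n, m)]); last by right.
case: nAB; have : finite_set ([set m | A (n, m)] `|` [set m | B (n, m)]).
  by rewrite finite_setU.
by apply: sub_finite_set.
Qed.

Lemma ground_fin_finT : ~ ground_fin_fin setT.
Proof.
move=> h; apply: infinite_nat; apply: sub_finite_set h => n _ /= h.
by apply: infinite_nat; apply: sub_finite_set h.
Qed.

Lemma finfin_le_refl A : finfin_le A A.
Proof.
rewrite /finfin_le setDv /ground_fin_fin.
apply: sub_finite_set (@finite_set0 nat) => n /=; apply.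
exact: sub_finite_set (@finite_set0 nat).
Qed.

Lemma finfin_le_trans A B C : finfin_le A B -> finfin_le B C -> finfin_le A C.
Proof.
move=> AB BC; apply: ground_fin_finW (ground_fin_finU AB BC).
move=> z [Az nCz]; have [Bz|nBz] := pselect (sval B z).
- by right.
- by left.
Qed.

Definition finfin_one : finfin_cond := exist _ setT ground_fin_finT.

Lemma finfin_le_one A : finfin_le A finfin_one.
Proof.
by apply: ground_fin_finW (finfin_le_refl A) => z [_ nT]; case: nT.
Qed.

Definition finfin_forcing : forcing_notion :=
  ForcingNotion finfin_le_refl finfin_le_trans finfin_le_one.

(* The canonical name {(check A, A) : A a condition} of the generic filter. *)
Definition generic_name : name finfin_forcing :=
  Name (fun A : finfin_forcing => check_rel (sval A))
       (fun A : finfin_forcing => A).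

End FinFinForcing.

(* Main.v *)
(** Write [I] for fin ⊗ fin.  A diagonal choice of columns shows that the
    forcing is sigma-closed, so no new subset of a countable set is added:
    every name for a subset of [nat], of [nat * nat] or of its square denotes
    a ground model set on a dense set of conditions, and a condition [q]
    forces a ground model set [A] into [G] iff [q \ A] is in [I].  This
    reduces every clause to combinatorics of [I] in the ground model.  The
    pseudo-intersection of a sequence decided by [q] is [q] itself, and
    rapidity amounts to thinning out the columns of a condition.

    For the Tukey equivalence, [C |-> {x | C_x <> 0}] maps [G . G] to [G].
    Conversely [B] is sent to the set of the [(x, y)] in [B^2] such that at
    least [x.1 + x.2] nonempty columns of [B] lie to the left of the column of
    [y].  Both maps are monotone and live in the ground model.  The second one
    has cofinal image: when [C] is in [G . G] and [q] decides which sections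
    [C_x] are in [G], one picks the [n]-th column of [B] inside the sections
    [C_x] with [x.1 + x.2 <= n]. *)

From mathcomp Require Import all_boot.
From mathcomp Require Import boolp classical_sets functions cardinality.
Require Import Defs.

Set Implicit Arguments.
Unset Strict Implicit.
Unset Printing Implicit Defensive.

Local Open Scope classical_set_scope.

(** * Regular sentences, equality and membership *)

(** These are the regular open sets of conditions, that is, the elements of the Boolean completion.
    Class parameters are arbitrary predicates of names and conditions, so regularity is carried as a
    hypothesis and inferred along the connectives. *)
Class regular (P : forcing_notion) (phi : sentence P) : Prop := Regular {
  regular_mono : forall p q : P, fle q p -> phi p -> phi q;
  regular_dense : forall p : P, dense_below phi p -> phi p }.

Section Density.
Context {P : forcing_notion}.
Implicit Types (p q r : P) (D E : P -> Prop) (phi psi : sentence P).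

Lemma forces_mono phi {phiR : regular phi} p q :
  fle q p -> (p ⊩ phi) -> q ⊩ phi.
Proof. exact: regular_mono. Qed.

Lemma dense_mono D p q : fle q p -> dense_below D p -> dense_below D q.
Proof. by move=> qp Dp r rq; apply: Dp; apply: fle_trans qp. Qed.

Lemma dense_intro D p : (forall q, fle q p -> D q) -> dense_below D p.
Proof. by move=> Dp q qp; exists q; [apply: fle_refl | apply: Dp]. Qed.

Lemma dense_ex D p : dense_below D p -> exists2 r, fle r p & D r.
Proof. by apply; apply: fle_refl. Qed.

Lemma dense_imply D E p : dense_below D p ->
  (forall r, fle r p -> D r -> E r) -> dense_below E p.
Proof.
move=> Dp DE q qp; have [r rq Dr] := Dp q qp; exists r => //.
by apply: DE => //; apply: fle_trans qp.
Qed.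

(** Working form of regularity: a regular goal may be proved at a dense set of stronger conditions,
    where existential statements have witnesses. *)
Lemma dense_elim phi {phiR : regular phi} D p : dense_below D p ->
  (forall r, fle r p -> D r -> phi r) -> phi p.
Proof. by move=> Dp Dphi; apply: regular_dense; apply: dense_imply Dphi. Qed.

Global Instance regular_dense_below D : regular (dense_below D).
Proof.
split=> [p q|p Dp q qp]; first exact: dense_mono.
have [r rq Dr] := Dp q qp; have [s sr Ds] := dense_ex Dr.
by exists s => //; apply: fle_trans rq.
Qed.

Lemma dense_bind D E p : dense_below D p ->
  (forall r, fle r p -> D r -> dense_below E r) -> dense_below E p.
Proof. exact: dense_elim. Qed.

Global Instance regular_fand phi psi :
  regular phi -> regular psi -> regular (fand phi psi).
Proof.
move=> phiR psiR; split=> [p q qp [hphi hpsi]|p h].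
  by split; apply: forces_mono qp _.
by split; apply: (dense_elim h) => r _ [].
Qed.

Global Instance regular_fex (phi : class P) : regular (fex phi).
Proof. exact: regular_dense_below. Qed.

Global Instance regular_fall (phi : class P) :
  (forall a, regular (phi a)) -> regular (fall phi).
Proof.
move=> phiR; split=> [p q qp h a|p h a]; first exact: forces_mono qp _.
by apply: (dense_elim h) => r _; apply.
Qed.

Global Instance regular_fimp phi psi :
  regular phi -> regular psi -> regular (fimp phi psi).
Proof.
move=> phiR psiR; split=> [p q qp h r rq|p h q qp hq].
  by apply: h; apply: fle_trans qp.
apply: (dense_elim (dense_mono qp h)) => r rq; apply; first exact: fle_refl.
exact: forces_mono rq hq.
Qed.

Global Instance regular_subclass (C D : class P) :
  (forall x, regular (C x)) -> (forall x, regular (D x)) ->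
  regular (subclass C D).
Proof. by move=> CR DR; apply: regular_fall. Qed.

End Density.

Section Equality.
Context {P : forcing_notion}.
Implicit Types (a b c d x y : name P) (p q r : P).

Global Instance regular_fmem a b : regular (fmem a b).
Proof. by case: b => J y d; apply: regular_dense_below. Qed.

Lemma feq_refl a p : p ⊩ a ≈ a.
Proof.
elim: a p => I x IH c p; split=> i q qp qi; apply: dense_intro => r rq;
  by exists i; [apply: fle_trans qi | apply: IH].
Qed.

Lemma feq_sym a b p : (p ⊩ a ≈ b) -> p ⊩ b ≈ a.
Proof.
elim: a b p => I x IH c [J y d] p [ab ba]; split=> [j|i] q qp qc.
  apply: dense_imply (ba j q qp qc) _ => r rq [i ri e].
  by exists i => //; apply: IH.
apply: dense_imply (ab i q qp qc) _ => r rq [j rj e].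
by exists j => //; apply: IH.
Qed.

Global Instance regular_feq a b : regular (feq a b).
Proof.
case: a b => [I x c] [J y d]; split=> [p q qp [ab ba]|p h].
  by split=> i r rq; [apply: ab | apply: ba]; apply: fle_trans qp.
split=> i q qp qi; apply: (dense_elim (dense_mono qp h)) => r rq [ab ba].
  by apply: ab; [apply: fle_refl | apply: fle_trans qi].
by apply: ba; [apply: fle_refl | apply: fle_trans qi].
Qed.

Lemma fmem_mono a b p q : fle q p -> (p ⊩ a ∈ b) -> q ⊩ a ∈ b.
Proof. exact: forces_mono. Qed.

Lemma feq_mono a b p q : fle q p -> (p ⊩ a ≈ b) -> q ⊩ a ≈ b.
Proof. exact: forces_mono. Qed.

Lemma feq_trans a b c p : (p ⊩ a ≈ b) -> (p ⊩ b ≈ c) -> p ⊩ a ≈ c.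
Proof.
elim: a b c p => I x IH cx [J y cy] [K z cz] p [ab ba] [bc cb].
split=> [i|k] q qp qc.
  apply: (dense_elim (ab i q qp qc)) => r rq [j rj xy].
  apply: dense_imply (bc j r (fle_trans rq qp) rj) _ => s sr [k sk yz].
  by exists k => //; apply: IH yz; apply: feq_mono sr xy.
apply: (dense_elim (cb k q qp qc)) => r rq [j rj yz].
apply: dense_imply (ba j r (fle_trans rq qp) rj) _ => s sr [i si xy].
by exists i => //; apply: IH xy _; apply: feq_mono sr yz.
Qed.

Lemma fmem_eql a a' b p : (p ⊩ a ≈ a') -> (p ⊩ a ∈ b) -> p ⊩ a' ∈ b.
Proof.
case: b => J y d aa' ab; apply: dense_imply ab _ => r rp [j rj ay].
exists j => //; apply: feq_trans ay; apply: feq_sym.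
exact: feq_mono rp aa'.
Qed.

Lemma fmem_eqr a b b' p : (p ⊩ b ≈ b') -> (p ⊩ a ∈ b) -> p ⊩ a ∈ b'.
Proof.
case: b b' => [J y d] [K z e] [bb' _] ab.
apply: (dense_elim ab) => r rp [j rj ay].
apply: dense_imply (bb' j r rp rj) _ => s sr [k sk yz].
by exists k => //; apply: feq_trans yz; apply: feq_mono sr ay.
Qed.

(** Extensional equality of classes as a statement of the metatheory, fit for rewriting. By [feqP]
    it amounts to forced equality when both classes are given by names. *)
Definition coextensive (C D : class P) p :=
  forall x q, fle q p -> (q ⊩ C x) <-> (q ⊩ D x).

Lemma coextensive_sym C D p : coextensive C D p -> coextensive D C p.
Proof. by move=> CD x q qp; split=> /(CD x q qp). Qed.

Lemma coextensive_trans C D E p :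
  coextensive C D p -> coextensive D E p -> coextensive C E p.
Proof. by move=> CD DE x q qp; rewrite CD // DE. Qed.

Lemma coextensive_mono C D p q :
  fle q p -> coextensive C D p -> coextensive C D q.
Proof. by move=> qp CD x r rq; apply: CD; apply: fle_trans qp. Qed.

Lemma coextensiveP C D p : coextensive C D p <-> (p ⊩ ∀ x, C x ⇔ D x).
Proof.
split=> [CD x|CD x q qp]; first by split=> q qp /(CD x q qp).
by split; apply: (CD x).1 || apply: (CD x).2.
Qed.

(** Extensionality: a branch [x i] belongs to its name below the condition [c i], so equality of
    elements yields both clauses of [feq]. *)
Lemma feqP a b p : (p ⊩ a ≈ b) <-> coextensive (elts a) (elts b) p.
Proof.
split=> [ab x q qp|].
  have {}ab : q ⊩ a ≈ b by apply: feq_mono qp ab.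
  by split; apply: fmem_eqr; last apply: feq_sym.
case: a b => [I x c] [J y d] ab; split=> [i|j] q qp qc.
  apply/(ab (x i) q qp)/dense_intro => r rq.
  by exists i; [apply: fle_trans qc | apply: feq_refl].
have /(ab (y j) q qp) : q ⊩ y j ∈ Name y d.
  apply: dense_intro => r rq.
  by exists j; [apply: fle_trans qc | apply: feq_refl].
move/dense_imply; apply=> r rq [i ri e]; exists i => //; exact: feq_sym.
Qed.

Lemma fmem_check_set (I : Type) (y : I -> name P) x p :
  (p ⊩ x ∈ check_set y) <-> dense_below (fun r => exists i, r ⊩ x ≈ y i) p.
Proof.
split=> /dense_imply; apply=> r _ [i]; first by exists i.
by exists i => //; apply: fle_one.
Qed.

Lemma fmem_upair a b x p :
  (p ⊩ x ∈ upair a b) <->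
  dense_below (fun r => (r ⊩ x ≈ a) \/ (r ⊩ x ≈ b)) p.
Proof.
rewrite fmem_check_set; split=> /dense_imply; apply=> r _.
  by case=> -[] e; [left | right].
by case=> e; [exists true | exists false].
Qed.

Lemma fmem_upairl a b p : p ⊩ a ∈ upair a b.
Proof. by apply/fmem_upair/dense_intro => q _; left; apply: feq_refl. Qed.

Lemma fmem_upairr a b p : p ⊩ b ∈ upair a b.
Proof. by apply/fmem_upair/dense_intro => q _; right; apply: feq_refl. Qed.

Arguments fmem_upairl : clear implicits.
Arguments fmem_upairr : clear implicits.

Lemma upair_congr a a' b b' p :
  (p ⊩ a ≈ a') -> (p ⊩ b ≈ b') -> p ⊩ upair a b ≈ upair a' b'.
Proof.
move=> aa' bb'; apply/feqP => x q qp.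
have {}aa' := feq_mono qp aa'; have {}bb' := feq_mono qp bb'.
split=> /fmem_upair/dense_imply h; apply/fmem_upair/h => r rq [] e;
  [left|right|left|right].
- exact: feq_trans e (feq_mono rq aa').
- exact: feq_trans e (feq_mono rq bb').
- exact: feq_trans e (feq_sym (feq_mono rq aa')).
- exact: feq_trans e (feq_sym (feq_mono rq bb')).
Qed.

Lemma opair_congr a a' b b' p :
  (p ⊩ a ≈ a') -> (p ⊩ b ≈ b') -> p ⊩ opair a b ≈ opair a' b'.
Proof. by move=> aa' bb'; do !apply: upair_congr. Qed.

Lemma upair_inj1 a b c p : (p ⊩ upair a b ≈ upair c c) -> p ⊩ b ≈ c.
Proof.
move=> e; have /fmem_upair : p ⊩ b ∈ upair c c.
  exact: fmem_eqr e (fmem_upairr a b _).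
by move/dense_elim; apply=> r _ [].
Qed.

Lemma opair_inj1 a b c d p : (p ⊩ opair a b ≈ opair c d) -> p ⊩ a ≈ c.
Proof.
move=> e; have /fmem_upair : p ⊩ upair a a ∈ opair c d.
  exact: fmem_eqr e (fmem_upairl _ _ _).
move/dense_elim; apply=> r _ [/upair_inj1//|/feq_sym f].
apply: feq_sym; have /fmem_upair := fmem_eqr f (fmem_upairl _ _ _).
by move/dense_elim; apply=> s _ [].
Qed.

Lemma opair_mem2 a b c d p : (p ⊩ opair a b ≈ opair c d) ->
  dense_below (fun r => (r ⊩ b ≈ c) \/ (r ⊩ b ≈ d)) p.
Proof.
move=> e; have /fmem_upair : p ⊩ upair a b ∈ opair c d.
  exact: fmem_eqr e (fmem_upairr _ _ _).
move/dense_bind; apply=> r _ [/upair_inj1 f|f].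
  by apply: dense_intro => q qr; left; apply: feq_mono qr f.
exact/fmem_upair/(fmem_eqr f)/fmem_upairr.
Qed.

(** The degenerate case is b = c. Then d is a or b by the symmetric argument, and a = c = b by
    [opair_inj1], so b = d either way. *)
Lemma opair_inj2 a b c d p : (p ⊩ opair a b ≈ opair c d) -> p ⊩ b ≈ d.
Proof.
move=> e; apply: (dense_elim (opair_mem2 e)) => r rp [bc|//].
have {}e := feq_mono rp e.
apply: (dense_elim (opair_mem2 (feq_sym e))) => s sr [da|]; last first.
  exact: feq_sym.
apply: feq_trans (feq_mono sr bc) _; apply: feq_sym.
exact: feq_trans da (feq_mono sr (opair_inj1 e)).
Qed.

End Equality.

(** * Names of natural numbers *)

Section Numerals.
Context {P : forcing_notion}.
Implicit Types (a b x : name P) (p : P).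

Lemma fmem_succ a x p :
  (p ⊩ x ∈ succ_name a) <->
  dense_below (fun r => (r ⊩ x ∈ a) \/ (r ⊩ x ≈ a)) p.
Proof.
case: a => I y c; split.
  move/dense_imply; apply=> r _ [[i|] ri e]; last by right.
  left; apply: dense_intro => s sr.
  by exists i; [apply: fle_trans ri | apply: feq_mono sr e].
move/dense_bind; apply=> r _ [h|e].
  by apply: dense_imply h _ => s _ [i si e]; exists (Some i).
apply: dense_intro => s sr; exists None; first exact: fle_one.
exact: feq_mono sr e.
Qed.

Lemma fmem_num n x p :
  (p ⊩ x ∈ num n) <->
  dense_below (fun r => exists2 i, i < n & r ⊩ x ≈ num i) p.
Proof.
elim: n p => [|n IH] p.
  rewrite fmem_check_set.
  by split=> /dense_imply; apply=> r _ [].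
rewrite fmem_succ; split=> /dense_bind; apply=> r _.
  case=> [/IH|e].
    by move/dense_imply; apply=> s _ [i ltin e]; exists i => //; apply: leqW.
  by apply: dense_intro => s sr; exists n => //; apply: feq_mono sr e.
case=> i; rewrite ltnS leq_eqVlt => /orP[/eqP->|ltin] e.
  by apply: dense_intro => s sr; right; apply: feq_mono sr e.
apply: dense_intro => s sr; left; apply/IH/dense_intro => t ts.
by exists i => //; apply: feq_mono e; apply: fle_trans sr.
Qed.

Lemma num_mem i n p : i < n -> p ⊩ num i ∈ num n.
Proof.
move=> ltin; apply/fmem_num/dense_intro => r _.
by exists i => //; apply: feq_refl.
Qed.

(** Were the two numerals equal, [num i] would be an element of itself, hence equal to some [num j]
    with j < i, against the induction hypothesis. *)
Lemma num_neq i n p : i < n -> ~ (p ⊩ num i ≈ num n).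
Proof.
elim/ltn_ind: n i p => n IH i p ltin e.
have /fmem_num/dense_ex[r _ [j ltji /feq_sym]] : p ⊩ num i ∈ num i.
  by apply: fmem_eqr (feq_sym e) _; apply: num_mem.
exact: IH.
Qed.

Lemma num_inj i n p : (p ⊩ num i ≈ num n) -> i = n.
Proof. by case: (ltngtP i n) => // lt; [|move/feq_sym]; move/(num_neq lt). Qed.

Lemma num_memE i n p : (p ⊩ num i ∈ num n) <-> i < n.
Proof.
split; last exact: num_mem.
by move=> /fmem_num/dense_ex[r _ [j ltj /num_inj->]].
Qed.

End Numerals.

(** * Names of ground model sets *)

(** Standard names for the elements of a ground type. Already one condition forcing two of them
    equal must identify the indices, which lets facts about names be read off in the metatheory. *)
Record naming (P : forcing_notion) (T : Type) := Naming {
  nm :> T -> name P;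
  nm_inj : forall t t' p, (p ⊩ nm t ≈ nm t') -> t = t' }.

Section Namings.
Context {P : forcing_notion}.
Implicit Types (X x y : name P) (p q r : P).

Definition num_naming : naming P nat := Naming (@num_inj P).

Lemma pair_naming_subproof T T' (N : naming P T) (N' : naming P T')
    (z z' : T * T') p :
  (p ⊩ opair (N z.1) (N' z.2) ≈ opair (N z'.1) (N' z'.2)) -> z = z'.
Proof.
case: z z' => [t1 t2] [u1 u2] /= e.
by rewrite (nm_inj (opair_inj1 e)) (nm_inj (opair_inj2 e)).
Qed.

Definition pair_naming T T' (N : naming P T) (N' : naming P T') :
    naming P (T * T') :=
  Naming (@pair_naming_subproof _ _ N N').

Definition chk T (N : naming P T) (A : set T) : name P :=
  check_set (fun z : {t : T | A t} => N (sval z)).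

(** [p] decides the extension of [C] to be the ground model set [A]. Here [C] is any formula, so the
    notion also applies to sections, intersections and preimages before they are known to be
    sets. *)
Definition denotes T (N : naming P T) (C : class P) (A : set T) (p : P) :=
  coextensive C (elts (chk N A)) p.

Section OneNaming.
Context {T : Type} (N : naming P T).
Implicit Types (A B : set T) (t : T) (C D : class P).

Lemma fmem_chk A x p : (p ⊩ x ∈ chk N A) <->
  dense_below (fun r => exists2 t, A t & r ⊩ x ≈ N t) p.
Proof.
split=> [/fmem_check_set|h]; last apply/fmem_check_set; last move: h.
  by move/dense_imply; apply=> r _ [[t At] e]; exists t.
by move/dense_imply; apply=> r _ [t At e]; exists (exist _ t At).
Qed.

Lemma fmem_chk_nm A x t p : (p ⊩ x ≈ N t) -> (p ⊩ x ∈ chk N A) <-> A t.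
Proof.
move=> e; split=> [/fmem_chk/dense_ex[r rp [u Au f]]|At].
  rewrite (@nm_inj _ _ N t u r) //; apply: feq_trans f.
  exact/feq_sym/feq_mono/e.
by apply/fmem_chk/dense_intro => r rp; exists t => //; apply: feq_mono e.
Qed.

Lemma denotes_mono C A p q : fle q p -> denotes N C A p -> denotes N C A q.
Proof. exact: coextensive_mono. Qed.

Lemma denotes_chk A p : denotes N (elts (chk N A)) A p.
Proof. by []. Qed.

Lemma denotes_nm C A x t p q : denotes N C A p -> fle q p -> (q ⊩ x ≈ N t) ->
  (q ⊩ C x) <-> A t.
Proof. by move=> CA qp e; rewrite (CA x q qp) (fmem_chk_nm A e). Qed.

(** Monotonicity for a class not assumed regular: it is inherited from membership in [chk N A]. *)
Lemma denotes_forces_mono C A x p q r : denotes N C A p -> fle q p ->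
  fle r q -> (q ⊩ C x) -> r ⊩ C x.
Proof.
move=> CA qp rq /(CA x q qp)/(fmem_mono rq) Cx.
by apply/CA => //; apply: fle_trans qp.
Qed.

Lemma denotes_elim C A x p q : denotes N C A p -> fle q p -> (q ⊩ C x) ->
  dense_below (fun r => exists2 t, A t & r ⊩ x ≈ N t) q.
Proof. by move=> CA qp Cx; apply/fmem_chk/CA. Qed.

(** It suffices to evaluate [C] on standard names once its elements are densely equal to such names;
    regularity of [C] glues the local answers. *)
Lemma denotes_intro C A p : (forall x, regular (C x)) ->
  (forall x q, fle q p -> (q ⊩ C x) ->
     dense_below (fun r => exists t, r ⊩ x ≈ N t) q) ->
  (forall x t q, fle q p -> (q ⊩ x ≈ N t) -> (q ⊩ C x) <-> A t) ->
  denotes N C A p.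
Proof.
move=> Creg Cdom CA x q qp; split=> [Cx|/fmem_chk Ax].
  apply/fmem_chk/(dense_imply (Cdom x q qp Cx)) => r rq [t e].
  exists t => //; apply/(CA x t r (fle_trans rq qp) e).
  exact: forces_mono rq Cx.
apply: (dense_elim Ax) => r rq [t At e].
exact/(CA x t r (fle_trans rq qp) e).
Qed.

Lemma denotes_feq X A p : denotes N (elts X) A p <-> (p ⊩ X ≈ chk N A).
Proof. by split=> /feqP. Qed.

Lemma denotes_inj C A B p : denotes N C A p -> denotes N C B p -> A = B.
Proof.
move=> CA CB; apply/seteqP; split=> t.
  move/(denotes_nm CA (fle_refl p) (feq_refl _ p)).
  by move/(denotes_nm CB (fle_refl p) (feq_refl _ p)).
move/(denotes_nm CB (fle_refl p) (feq_refl _ p)).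
by move/(denotes_nm CA (fle_refl p) (feq_refl _ p)).
Qed.

Lemma subclass_denotes C D A B p : denotes N C A p -> denotes N D B p ->
  (p ⊩ subclass C D) <-> A `<=` B.
Proof.
move=> CA DB; split=> [CD t|AB x q qp Cx].
  move/(denotes_nm CA (fle_refl p) (feq_refl _ p))/(CD _ _ (fle_refl p)).
  by move/(denotes_nm DB (fle_refl p) (feq_refl _ p)).
apply/(DB x q qp)/fmem_chk/(dense_imply (denotes_elim CA qp Cx)) => r _.
by case=> t At e; exists t => //; apply: AB.
Qed.

Lemma denotes_capc C D A B p : denotes N C A p -> denotes N D B p ->
  denotes N (capc C D) (A `&` B) p.
Proof.
move=> CA DB x q qp; split=> [[Cx Dx]|/fmem_chk h].
  apply/fmem_chk/(dense_imply (denotes_elim CA qp Cx)) => r rq [t At e].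
  exists t => //; split=> //; have rp := fle_trans rq qp.
  exact/(denotes_nm DB rp e)/(denotes_forces_mono DB qp rq).
split; [apply/CA|apply/DB] => //; apply/fmem_chk/(dense_imply h);
  by move=> r _ [t [At Bt] e]; exists t.
Qed.

Lemma denotes_diffc C D A B p : denotes N C A p -> denotes N D B p ->
  denotes N (diffc C D) (A `\` B) p.
Proof.
move=> CA DB x q qp; split=> [[Cx Dx]|/fmem_chk h].
  apply/fmem_chk/(dense_imply (denotes_elim CA qp Cx)) => r rq [t At e].
  exists t => //; split=> // Bt; apply: (Dx r rq).
  by have rp := fle_trans rq qp; apply/(denotes_nm DB rp e).
split.
  apply/CA => //; apply/fmem_chk/(dense_imply h) => r _ [t [At _] e].
  by exists t.
move=> r rq Dx; have /dense_ex[s sr [t [_ nBt] e]] := dense_mono rq h.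
have rp := fle_trans rq qp; apply: nBt.
exact/(denotes_nm DB (fle_trans sr rp) e)/(denotes_forces_mono DB rp sr).
Qed.

End OneNaming.

Arguments denotes_chk {T} N A {p}.

Section TwoNamings.
Context {T T' : Type} (N : naming P T) (N' : naming P T').
Implicit Types (C D : class P).

Lemma opair_chk (A : set (T * T')) x y t t' p : (p ⊩ x ≈ N t) ->
  (p ⊩ y ≈ N' t') -> (p ⊩ opair x y ∈ chk (pair_naming N N') A) <-> A (t, t').
Proof. by move=> ex ey; apply: fmem_chk_nm; apply: opair_congr. Qed.

Lemma opair_chk_elim (A : set (T * T')) x y p :
  (p ⊩ opair x y ∈ chk (pair_naming N N') A) ->
  dense_below (fun r => exists t t',
    [/\ A (t, t'), r ⊩ x ≈ N t & r ⊩ y ≈ N' t']) p.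
Proof.
move=> /fmem_chk /dense_imply; apply=> r _ [[t t'] At e].
by exists t, t'; split; [|apply: opair_inj1 e|apply: opair_inj2 e].
Qed.

Lemma denotes_prodc C D A B p : denotes N C A p -> denotes N' D B p ->
  denotes (pair_naming N N') (prodc C D) (A `*` B) p.
Proof.
move=> CA DB z q qp; split=> [h|/fmem_chk h].
  apply/fmem_chk; apply: (dense_bind h) => r rq [x].
  move/dense_bind; apply=> s sr [y [Cx [Dy e]]].
  have sp := fle_trans sr (fle_trans rq qp).
  apply: (dense_bind (denotes_elim CA sp Cx)) => u us [t At ex].
  have up := fle_trans us sp.
  have {}Dy := denotes_forces_mono DB sp us Dy.
  apply: (dense_imply (denotes_elim DB up Dy)) => v vu [t' Bt ey].
  exists (t, t') => //; apply: feq_trans (feq_mono (fle_trans vu us) e) _.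
  by apply: opair_congr => //; apply: feq_mono ex.
apply: (dense_imply h) => r rq [[t t'] [/= At Bt] e].
have rp := fle_trans rq qp; exists (N t); apply: dense_intro => s sr.
have sp := fle_trans sr rp.
exists (N' t'); split; first exact/(denotes_nm CA sp (feq_refl _ s)).
split; first exact/(denotes_nm DB sp (feq_refl _ s)).
exact: feq_mono e.
Qed.

(** Serves both the columns in [fin_fin] and the sections in [fubini_square]. *)
Lemma denotes_slice C X A x t p : denotes N' C setT p ->
  denotes (pair_naming N N') (elts X) A p -> (p ⊩ x ≈ N t) ->
  denotes N' (fun y => C y ∧ opair x y ∈ X)%F [set t' | A (t, t')] p.
Proof.
move=> CT XA ex y q qp; split=> [[Cy xyX]|/fmem_chk h].
  apply/fmem_chk/(dense_imply (denotes_elim CT qp Cy)) => r rq [t' _ e].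
  exists t' => //=; have rp := fle_trans rq qp.
  apply/(opair_chk A (feq_mono rp ex) e)/(XA _ r rp).
  exact: fmem_mono xyX.
split.
  by apply/CT => //; apply/fmem_chk/(dense_imply h) => r _ [t' _ e]; exists t'.
apply: (dense_elim h) => r rq [t' At e]; have rp := fle_trans rq qp.
exact/(XA _ r rp)/(opair_chk A (feq_mono rp ex) e).
Qed.

End TwoNamings.

Lemma denotes_omegac p : denotes num_naming omegac setT p.
Proof.
move=> x q _; split=> [/fmem_check_set|/fmem_chk] h.
  by apply/fmem_chk/(dense_imply h) => r _ [n e]; exists n.
by apply/fmem_check_set/(dense_imply h) => r _ [n _ e]; exists n.
Qed.

Lemma denotes_num n p : denotes num_naming (elts (num n)) `I_n p.
Proof.
by move=> x q _; split=> [/fmem_num h|/fmem_chk h];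
  [apply/fmem_chk | apply/fmem_num].
Qed.

Definition rel_naming : naming P (nat * nat) :=
  pair_naming num_naming num_naming.

Lemma denotes_omega2 p : denotes rel_naming omega2 setT p.
Proof. by rewrite -setXTT; apply: denotes_prodc; apply: denotes_omegac. Qed.

Lemma denotes_proj_preimage X B p : denotes num_naming (elts X) B p ->
  denotes rel_naming (proj_preimage X) (fst @^-1` B) p.
Proof.
move=> XB z q qp; split=> [h|/fmem_chk h].
  apply/fmem_chk; apply: (dense_bind h) => r rq [n].
  move/dense_bind; apply=> s sr [m [_ [mo [ez nX]]]].
  have sp := fle_trans sr (fle_trans rq qp).
  apply: (dense_bind (denotes_elim XB sp nX)) => u us [i Bi en].
  have {}mo := denotes_forces_mono (denotes_omegac (p := s)) (fle_refl s) us mo.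
  apply: (dense_imply (denotes_elim (denotes_omegac (p := s)) us mo)).
  move=> v vu [j _ em]; exists (i, j) => //.
  apply: feq_trans (feq_mono (fle_trans vu us) ez) _.
  by apply: opair_congr => //; apply: feq_mono en.
apply: (dense_imply h) => r rq [[i j] /= Bi e]; have rp := fle_trans rq qp.
exists (num i); apply: dense_intro => s sr; have sp := fle_trans sr rp.
exists (num j).
split.
  exact/(denotes_nm (denotes_omegac (p := s)) (fle_refl s) (feq_refl _ s)).
split.
  exact/(denotes_nm (denotes_omegac (p := s)) (fle_refl s) (feq_refl _ s)).
split; first exact: feq_mono e.
exact/(denotes_nm XB sp (feq_refl _ s)).
Qed.

End Namings.

Arguments denotes_chk {P T} N A {p}.
Arguments denotes_omegac {P p}.
Arguments denotes_omega2 {P p}.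
Arguments denotes_num {P} n {p}.

(** * Functions of the extension and functions named from the ground model *)

Section GroundFunctions.
Context {P : forcing_notion}.
Implicit Types (X x y f : name P) (p q r : P) (C D : class P).

(** [D] is not known to respect forced equality. So the value returned is the second component
    provided by the inclusion of [f] in the product; injectivity of pairing identifies it with the
    value given by totality. *)
Lemma is_fun_val f C D x p q : (p ⊩ is_fun f C D) -> fle q p -> (q ⊩ C x) ->
  dense_below (fun r => exists y, [/\ r ⊩ D y, r ⊩ opair x y ∈ f &
    r ⊩ ∀ y', opair x y' ∈ f ⇒ y' ≈ y]) q.
Proof.
move=> [fCD ftot] qp Cx.
apply: (dense_bind (ftot x q qp Cx)) => r rq [y [xyf yu]].
apply: (dense_bind (fCD _ r (fle_trans rq qp) xyf)) => s sr [x'].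
move/dense_imply; apply=> u us [y' [_ [Dy' e]]]; have ur := fle_trans us sr.
have yy' := opair_inj2 e; exists y'; split=> //.
  apply: fmem_eql (fmem_mono ur xyf).
  by apply: opair_congr => //; apply: feq_refl.
move=> z v vu xzf; apply: feq_trans (feq_mono vu yy').
by apply: yu => //; apply: fle_trans ur.
Qed.

Lemma is_fun_functional f C D x y y' p q : (p ⊩ is_fun f C D) -> fle q p ->
  (q ⊩ C x) -> (q ⊩ opair x y ∈ f) -> (q ⊩ opair x y' ∈ f) -> q ⊩ y ≈ y'.
Proof.
move=> ffun qp Cx xy xy'; apply: (dense_elim (is_fun_val ffun qp Cx)).
move=> r rq [z [_ _ zu]].
apply: feq_trans (zu y r (fle_refl r) (fmem_mono rq xy)) _; apply: feq_sym.
exact: (zu y' r (fle_refl r) (fmem_mono rq xy')).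
Qed.

Lemma is_fun_num f D n y p q : (p ⊩ is_fun f omegac D) -> fle q p ->
  (q ⊩ opair n y ∈ f) ->
  dense_below (fun r => exists2 i, r ⊩ n ≈ num i & r ⊩ opair (num i) y ∈ f) q.
Proof.
move=> [fD _] qp nyf; apply: (dense_bind (fD _ q qp nyf)) => r rq [n'].
move/dense_bind; apply=> s sr [y' [n'o [_ e]]]; have sq := fle_trans sr rq.
apply: (dense_imply (denotes_elim denotes_omegac (fle_refl s) n'o)).
move=> t ts [i _ ei].
have ni : t ⊩ n ≈ num i := feq_trans (feq_mono ts (opair_inj1 e)) ei.
exists i => //; apply: fmem_eql (fmem_mono (fle_trans ts sq) nyf).
by apply: opair_congr => //; apply: feq_refl.
Qed.

Context {T T' : Type} (N : naming P T) (N' : naming P T').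

Definition ground_fun (A : set T) (g : T -> T') : name P :=
  chk (pair_naming N N') [set z | A z.1 /\ z.2 = g z.1].

Lemma opair_gAnelim A g x y p : (p ⊩ opair x y ∈ ground_fun A g) ->
  dense_below (fun r => exists t, [/\ A t, r ⊩ x ≈ N t & r ⊩ y ≈ N' (g t)]) p.
Proof.
move/opair_chk_elim/dense_imply; apply=> r _ [t [_ [[/= At ->] ex ey]]].
by exists t.
Qed.

Lemma opair_ground_fun A g x y t p :
  A t -> (p ⊩ x ≈ N t) -> (p ⊩ y ≈ N' (g t)) ->
  p ⊩ opair x y ∈ ground_fun A g.
Proof. by move=> At ex ey; apply/(opair_chk _ ex ey). Qed.

Lemma is_fun_ground_fun C D A B g p : denotes N C A p -> denotes N' D B p ->
  (forall t, A t -> B (g t)) -> p ⊩ is_fun (ground_fun A g) C D.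
Proof.
move=> CA DB gAB; split.
  apply/(subclass_denotes (denotes_chk _ _)(denotes_prodc CA DB)).
  by move=> [t t'] [/= At ->]; split=> //=; apply: gAB.
move=> x q qp Cx.
apply: (dense_imply (denotes_elim CA qp Cx)) => r rq [t At ex].
exists (N' (g t)); split; first exact: (opair_ground_fun At ex (feq_refl _ r)).
move=> y s sr /opair_gAnelim h; apply: (dense_elim h) => u us [t' [At' ex' ey]].
suff -> : t = t' by [].
apply: (@nm_inj _ _ N t t' u); apply: feq_trans ex'; apply: feq_sym.
by apply: feq_mono ex; apply: fle_trans sr.
Qed.

Lemma is_inj_ground_fun A g p :
  (forall t t', A t -> A t' -> g t = g t' -> t = t') ->
  p ⊩ is_inj (ground_fun A g).
Proof.
move=> ginj x x' y q qp [/opair_gAnelim h /opair_gAnelim h'].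
apply: (dense_elim h) => r rq [t [At ex ey]].
apply: (dense_elim (dense_mono rq h')) => s sr [t' [At' ex' ey']].
apply: feq_trans (feq_mono sr ex) (feq_sym _).
suff -> : t = t' by [].
apply: ginj => //; apply: (@nm_inj _ _ N' (g t) (g t') s).
by apply: feq_trans ey'; apply/feq_sym/feq_mono/ey.
Qed.

Lemma is_onto_ground_fun D A g p : denotes N' D (g @` A) p ->
  p ⊩ is_onto (ground_fun A g) D.
Proof.
move=> DB y q qp Dy; apply: (dense_imply (denotes_elim DB qp Dy)) => r rq.
case=> t' [t At <-] ey; exists (N t).
exact: opair_ground_fun (feq_refl _ _) ey.
Qed.

End GroundFunctions.

Arguments ground_fun {P T T'} N N' A g.

(** * Sigma-closed forcings: countable decisions and absoluteness of finiteness *)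

Definition sigma_closed (P : forcing_notion) := forall s : nat -> P,
  (forall n, fle (s n.+1) (s n)) -> exists q, forall n, fle q (s n).

Section SigmaClosed.
Context {P : forcing_notion}.
Hypothesis Pclosed : sigma_closed P.
Implicit Types (X x y f : name P) (p q r : P) (C D : class P).

(** Meet the sets [D t] one after another along a decreasing sequence of conditions; a lower bound
    of the sequence lies in all of them. *)
Lemma sigma_distributive (T : countType) (D : T -> P -> Prop) p :
  (forall t q r, fle r q -> D t q -> D t r) ->
  (forall t, dense_below (D t) p) ->
  dense_below (fun q => forall t, D t q) p.
Proof.
move=> Dmono Ddense q0 q0p.
(* Stage n treats the element with code n, and keeps the condition when n codes nothing. *)
have step (nq : nat * {q | fle q p}) : exists r : {q | fle q p},
    fle (sval r) (sval nq.2) /\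
    forall t, unpickle nq.1 = Some t -> D t (sval r).
  case: nq => n [q qp] /=; case: (unpickle n) => [t|]; last first.
    by exists (exist _ q qp); split=> //; apply: fle_refl.
  have [r rq Dr] := Ddense t q qp.
  by exists (exist _ r (fle_trans rq qp)); split=> // _ [<-].
have [g gP] := choice step.
pose s := fix s n := if n is m.+1 then g (m, s m) else exist _ q0 q0p.
have [|q qs] := @Pclosed (fun n => sval (s n)).
  by move=> n; case: (gP (n, s n)).
exists q => [|t]; first exact: (qs 0).
(* The element [t] is treated in passing from stage [pickle t] to the next one. *)
apply: (Dmono t _ _ (qs (pickle t).+1)).
by apply: (gP (pickle t, s (pickle t))).2; rewrite /= pickleK.
Qed.

Section Countable.
Context {T : countType} (N : naming P T).
Implicit Types (A B : set T) (t : T).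

(* Sigma-closed forcings add no new subset of [T]. *)
Lemma subset_denotes X p : (p ⊩ subclass (elts X) (elts (chk N setT))) ->
  dense_below (fun q => exists A, denotes N (elts X) A q) p.
Proof.
move=> XT; pose D t q := (q ⊩ N t ∈ X) \/ (q ⊩ ¬ N t ∈ X).
have /dense_imply : dense_below (fun q => forall t, D t q) p.
  apply: sigma_distributive => [t q r rq [h|h]|t q qp].
  - by left; apply: fmem_mono h.
  - by right=> s sr; apply: h; apply: fle_trans rq.
  have [[r rq h]|h] := pselect (exists2 r, fle r q & r ⊩ N t ∈ X).
    by exists r => //; left.
  exists q; first exact: fle_refl.
  by right=> r rq rX; apply: h; exists r.
apply=> q qp decided; exists [set t | q ⊩ N t ∈ X].
apply: denotes_intro => [x r rq|x t r rq e].
  move/(XT x r (fle_trans rq qp))/fmem_chk/dense_imply; apply=> s _ [t _ e].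
  by exists t.
split=> [xX /=|/= tX]; last first.
  by apply: fmem_eql (feq_sym e) _; apply: fmem_mono rq tX.
case: (decided t) => // /(_ r rq); case.
exact: fmem_eql e xX.
Qed.

(** A ground bijection with an initial segment is named by [ground_fun]. Conversely, a forced
    injection into a numeral has only countably many values to decide, so one condition decides all
    of them and yields an injection in the ground model. *)
Lemma is_finite_denotes C A p : denotes N C A p ->
  (p ⊩ is_finite C) <-> finite_set A.
Proof.
move=> CA; split=> [|/finite_setP[n An]]; last first.
  apply: dense_intro => q qp; exists (num n); split.
    exact/(denotes_nm denotes_omegac (fle_refl q) (feq_refl _ q)).
  have [g [gAn ginj gsurj]] := card_set_bijP An.
  apply: dense_intro => r rq; exists (ground_fun N num_naming A g).
  have rp := fle_trans rq qp.
  split.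
    exact: is_fun_ground_fun (denotes_mono rp CA) (denotes_num _) gAn.
  split.
    by apply: is_inj_ground_fun => t t' At At'; apply: ginj; rewrite inE.
  apply: is_onto_ground_fun; suff -> : g @` A = `I_n by apply: denotes_num.
  by apply/seteqP; split=> // _ [t At <-]; apply: gAn.
move/dense_ex=> [q qp [n [no]]].
have /dense_ex[r rq [k _ ek]] := denotes_elim denotes_omegac (fle_refl q) no.
move/(dense_mono rq)/dense_ex=> [s sr [f [ffun [finj _]]]].
have sp := fle_trans sr (fle_trans rq qp).
have nk : denotes num_naming (elts n) `I_k s.
  by apply/denotes_feq; apply: feq_trans (feq_mono sr ek) _;
     apply/denotes_feq/denotes_num.
pose D t u := A t -> exists2 i, i < k & u ⊩ opair (N t) (num i) ∈ f.
have /dense_ex[u us Du] : dense_below (fun u => forall t, D t u) s.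
  apply: sigma_distributive => [t u v vu Dtu At|t u us].
    by have [i ik h] := Dtu At; exists i => //; apply: fmem_mono h.
  have [At|nAt] := pselect (A t); last by exists u; [apply: fle_refl|].
  have Ct : u ⊩ C (N t).
    by apply/(denotes_nm CA (fle_trans us sp) (feq_refl _ u)).
  have [v vu [y [yn tyf _]]] := dense_ex (is_fun_val ffun us Ct).
  have /dense_ex[w wv [i ik e]] := denotes_elim nk (fle_trans vu us) yn.
  exists w => [|_]; first exact: fle_trans vu.
  exists i => //; apply: fmem_eql (fmem_mono wv tyf).
  by apply: opair_congr => //; apply: feq_refl.
(* Outside [A] the value is the default 0. *)
have : forall t, exists i, A t -> i < k /\ (u ⊩ opair (N t) (num i) ∈ f).
  move=> t; have [At|nAt] := pselect (A t); last by exists 0.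
  by have [i ik h] := Du t At; exists i.
case/choice=> g gP; rewrite -(eq_finite_set (inj_card_eq (f := g) _)).
  by apply: sub_finite_set (finite_II k) => _ [t At <-]; case: (gP t At).
move=> t t' /set_mem At /set_mem At' e.
have [_ h] := gP t At; have [_ h'] := gP t' At'; rewrite -e in h'.
exact: (nm_inj (finj _ _ _ u us (conj h h'))).
Qed.

Lemma card_le_denotes C A (g : T -> nat) m n p : denotes N C A p ->
  (p ⊩ m ≈ num n) -> (forall t, A t -> g t < n) ->
  (forall t t', A t -> A t' -> g t = g t' -> t = t') -> p ⊩ card_le C m.
Proof.
move=> CA mn gn ginj; apply: dense_intro => q qp.
exists (ground_fun N num_naming A g); split; last exact: is_inj_ground_fun.
apply: (is_fun_ground_fun (B := `I_n) (denotes_mono qp CA) _ gn).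
apply/denotes_feq.
exact: feq_trans (feq_mono qp mn) ((denotes_feq _ _ _ _).1 (denotes_num n)).
Qed.

End Countable.

(** The ideal is absolute: each column of [X] denotes a column of [A], so [is_finite_denotes]
    decides which columns are infinite; applied again to the set of these columns, it decides
    membership in the ideal. *)
Lemma fin_fin_denotes X A p : denotes rel_naming (elts X) A p ->
  (p ⊩ fin_fin X) <-> ground_fin_fin A.
Proof.
move=> XA.
pose C : class P := fun n => (n ∈ omega ∧ ¬ is_finite (section_at X n))%F.
have CA : denotes num_naming C [set n | ~ finite_set [set m | A (n, m)]] p.
  apply: denotes_intro => [x|x q qp [xo _]|x n q qp e].
  - split=> [q r rq [xo nf]|q h].
      split; first exact: fmem_mono xo.
      by move=> s sr; apply: nf; apply: fle_trans rq.
    split; first by apply: (dense_elim h) => r _ [].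
    move=> r rq fin; have [s sr [_ nf]] := h r rq; apply: (nf s (fle_refl s)).
    exact: forces_mono sr fin.
  - apply: (dense_imply (denotes_elim denotes_omegac (fle_refl q) xo)).
    by move=> r _ [n _ e]; exists n.
  have sect r : fle r q -> (r ⊩ is_finite (section_at X x)) <->
      finite_set [set m | A (n, m)].
    move=> rq; apply: is_finite_denotes.
    have rp := fle_trans rq qp.
    exact: (denotes_slice denotes_omegac (denotes_mono rp XA) (feq_mono rq e)).
  split=> [[_ nf] /(sect q (fle_refl q))|/= nf]; first exact: nf (fle_refl q).
  split; first exact/(denotes_nm denotes_omegac (fle_refl q) e).
  by move=> r rq /(sect r rq).
split=> [[_ /(is_finite_denotes CA)]|] //.
move=> fA; split; last exact/(is_finite_denotes CA).
exact/(subclass_denotes XA denotes_omega2).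
Qed.

End SigmaClosed.

(** * Families of sets in the extension, reduced to the ground model *)

Section Families.
Context {P : forcing_notion}.
Hypothesis Pclosed : sigma_closed P.
Implicit Types (X Y x y f : name P) (p q r : P) (C S : class P).

(** [u] is the forcing relation for [U] restricted to ground model sets. For a countable [T] and a
    sigma-closed forcing it determines the subsets of [T] in [U], since none of them is new. *)
Definition represents (T : Type) (N : naming P T) (U : class P)
    (u : P -> set (set T)) :=
  forall X A q, denotes N (elts X) A q -> (q ⊩ U X) <-> u q A.

Section OneFamily.
Context {T : countType} (N : naming P T) (S U : class P)
  (u : P -> set (set T)).
Hypotheses (Ureg : forall X, regular (U X)) (Urep : represents N U u)
  (S_T : forall p, denotes N S setT p)
  (U_S : forall X p, (p ⊩ U X) -> p ⊩ subclass (elts X) S).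

Lemma represents_regular A : regular (u ^~ A).
Proof.
have uE q : u q A <-> (q ⊩ U (chk N A)) := iff_sym (Urep (denotes_chk N A)).
split=> [p q qp /uE h|p h]; first exact/uE/(forces_mono qp h).
by apply/uE; apply: (dense_elim h) => q _ /uE.
Qed.

Lemma represents_mono A p q : fle q p -> u p A -> u q A.
Proof. exact: (@regular_mono _ _ (represents_regular A)). Qed.

Lemma represents_subset X p : (p ⊩ subclass (elts X) S) ->
  dense_below (fun q => exists A, denotes N (elts X) A q) p.
Proof.
move=> XS; apply: (subset_denotes Pclosed) => x q qp /(XS x q qp) Sx.
exact/(@S_T _ _ _ (fle_refl q)).
Qed.

Lemma represents_elim X p : (p ⊩ U X) ->
  dense_below (fun q => exists2 A, denotes N (elts X) A q & u q A) p.
Proof.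
move=> UX; apply: (dense_imply (represents_subset (U_S UX))) => q qp [A XA].
by exists A => //; apply/(Urep XA); apply: forces_mono qp UX.
Qed.

Lemma class_in_denotes C A p : denotes N C A p ->
  (p ⊩ class_in C U) <-> u p A.
Proof.
move=> CA; split=> [h|uA].
  apply: (@dense_elim _ (u ^~ A) (represents_regular A) _ _ h) => q qp.
  move=> [X [UX /coextensiveP XC]]; move: UX.
  by apply: (Urep _).1; apply: coextensive_trans XC (denotes_mono qp CA).
apply: dense_intro => q qp; exists (chk N A); split.
  apply: (Urep (denotes_chk N A)).2.
  exact: represents_mono qp uA.
exact/coextensiveP/coextensive_sym/(denotes_mono qp CA).
Qed.

(** On a dense set of conditions all the sets involved are ground model sets, where each clause
    becomes the corresponding closure property of [u]. *)
Lemma is_ultrafilter_represents p :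
  (forall q, u q setT) -> (forall q, ~ u q set0) ->
  (forall q A B, u q A -> u q B -> u q (A `&` B)) ->
  (forall q A B, A `<=` B -> u q A -> u q B) ->
  (forall q A, dense_below (fun r => u r A \/ u r (~` A)) q) ->
  p ⊩ is_ultrafilter S U.
Proof.
move=> uT u0 uI uW uC; split; [|split; [|split; [|split; [|split]]]].
- by move=> X q qp; apply: U_S.
- exact/(class_in_denotes (@S_T p)).
- move=> q qp; have E : denotes N (@emptyc P) set0 q.
    move=> x r rq; split=> [/(_ r (fle_refl r))|/fmem_chk h s sr].
      by case; apply: feq_refl.
    by have /dense_ex[? _ []] := dense_mono sr h.
  by move/(class_in_denotes E); apply: u0.
- move=> X Y q qp [UX UY]; apply: (dense_elim (represents_elim UX)).
  move=> r rq [A XA uA].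
  apply: (dense_elim (represents_elim (forces_mono rq UY))) => s sr [B YB uB].
  apply/(class_in_denotes (denotes_capc (denotes_mono sr XA) YB)).
  apply: uI => //.
  exact: represents_mono sr uA.
- move=> X Y q qp [UX [XY YS]]; apply: (dense_elim (represents_elim UX)).
  move=> r rq [A XA uA].
  apply: (dense_elim (dense_mono rq (represents_subset YS))) => s sr [B YB].
  apply/(Urep YB).
  have {}XA := denotes_mono sr XA.
  apply: (uW s A); last exact: represents_mono sr uA.
  by apply/(subclass_denotes XA YB)/(forces_mono (fle_trans sr rq)).
move=> X q qp XS; apply: (dense_bind (represents_subset XS)) => r rq [A XA].
apply: (dense_imply (uC r A)) => s sr; have {}XA := denotes_mono sr XA.
case=> h; [left|right]; first exact/(Urep XA).
by apply/(class_in_denotes (denotes_diffc (@S_T s) XA)); rewrite setTD.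
Qed.

End OneFamily.

Section Tukey.
Context {T T' : countType} (N : naming P T) (N' : naming P T').
Context (S U S' U' : class P) (u : P -> set (set T)) (u' : P -> set (set T')).
Hypotheses (Ureg : forall X, regular (U X)) (Urep : represents N U u)
  (S_T : forall p, denotes N S setT p)
  (U_S : forall X p, (p ⊩ U X) -> p ⊩ subclass (elts X) S).
Hypotheses (U'reg : forall X, regular (U' X)) (U'rep : represents N' U' u')
  (S'_T : forall p, denotes N' S' setT p)
  (U'_S' : forall X p, (p ⊩ U' X) -> p ⊩ subclass (elts X) S').
Variable phi : set T -> set T'.

(* The restriction of the ground model function [phi] to [U]. *)
Definition family_fun : name P :=
  Name (fun z : {z : set T * P | u z.2 z.1} =>
          opair (chk N (sval z).1) (chk N' (phi (sval z).1)))
       (fun z => (sval z).2).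

Lemma fmem_family_fun z p : (p ⊩ z ∈ family_fun) <->
  dense_below (fun r => exists2 A, u r A &
    r ⊩ z ≈ opair (chk N A) (chk N' (phi A))) p.
Proof.
split=> /dense_imply; apply=> r _.
  case=> -[[A q] /= uA] /= rq e; exists A => //.
  exact: (represents_mono Ureg (@Urep) rq uA).
by case=> A uA e; exists (exist _ (A, r) uA) => //; apply: fle_refl.
Qed.

Lemma opair_family_fun_elim x y p : (p ⊩ opair x y ∈ family_fun) ->
  dense_below (fun r => exists A,
    [/\ u r A, denotes N (elts x) A r & denotes N' (elts y) (phi A) r]) p.
Proof.
move/fmem_family_fun/dense_imply; apply=> r _ [A uA e]; exists A.
by split=> //; apply/denotes_feq; [apply: opair_inj1 e | apply: opair_inj2 e].
Qed.

Lemma opair_family_fun x y A p : u p A -> denotes N (elts x) A p ->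
  denotes N' (elts y) (phi A) p -> p ⊩ opair x y ∈ family_fun.
Proof.
move=> uA xA yA; apply/fmem_family_fun/dense_intro => q qp; exists A.
  exact: (represents_mono Ureg (@Urep) qp uA).
by apply: feq_mono qp _; apply: opair_congr; apply/denotes_feq.
Qed.

(** A monotone map with cofinal image preserves cofinality. Given B, choose A with [phi A] inside B,
    then a member A' of the cofinal family inside A; now [phi A'] lies inside [phi A], hence inside
    B. *)
Lemma tukey_le_represents p :
  (forall q A, u q A -> u' q (phi A)) ->
  (forall A B, A `<=` B -> phi A `<=` phi B) ->
  (forall q B, u' q B ->
    dense_below (fun r => exists2 A, u r A & phi A `<=` B) q) ->
  p ⊩ tukey_le U' supset U supset.
Proof.
move=> phiU phi_homo phi_cof; apply: dense_intro => {}p _.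
exists family_fun; split; first split.
- move=> z q qp /fmem_family_fun/dense_imply; apply=> r rq [A uA e].
  exists (chk N A); apply: dense_intro => s sr; exists (chk N' (phi A)).
  have {}uA := represents_mono Ureg (@Urep) sr uA.
  split; first exact: (Urep (denotes_chk N A)).2.
  split; last exact: feq_mono e.
  exact/(U'rep (denotes_chk N' _)).2/phiU.
- move=> x q qp Ux.
  apply: (dense_imply (represents_elim Ureg (@Urep) (@S_T) (@U_S) Ux)).
  move=> r rq [A xA uA]; exists (chk N' (phi A)).
  split; first exact: opair_family_fun xA (denotes_chk N' _).
  move=> y s sr /opair_family_fun_elim h; apply: (dense_elim h) => t ts.
  move=> [A' [_ xA' yA']]; apply/denotes_feq.
  by rewrite (denotes_inj (denotes_mono (fle_trans ts sr) xA) xA').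
move=> X q qp [XU Xcof]; split=> [y r rq h|x r rq U'x].
  apply: (dense_elim h) => s sr [x [xX]].
  move/opair_family_fun_elim/dense_elim; apply=> t ts [A [uA _ yA]].
  exact/(U'rep yA).2/phiU.
apply: (dense_bind (represents_elim U'reg (@U'rep) (@S'_T) (@U'_S') U'x)).
move=> s sr [B xB u'B]; apply: (dense_bind (phi_cof s B u'B)) => t ts [A uA AB].
have tq := fle_trans ts (fle_trans sr rq).
have UA : t ⊩ U (chk N A) := (Urep (denotes_chk N A)).2 uA.
apply: (dense_bind (Xcof _ t tq UA)) => v vt [z [zX zA]].
have Uz := XU _ v (fle_trans vt tq) zX.
apply: (dense_imply (represents_elim Ureg (@Urep) (@S_T) (@U_S) Uz)).
move=> w wv [A' zA' uA']; exists (chk N' (phi A')); split.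
  apply: dense_intro => o ow; exists z; split.
    by apply: fmem_mono zX; apply: fle_trans wv.
  apply: opair_family_fun (denotes_mono ow zA') (denotes_chk N' _).
  exact: (represents_mono Ureg (@Urep) ow uA').
have xB' := denotes_mono (fle_trans wv (fle_trans vt ts)) xB.
apply/(subclass_denotes (denotes_chk N' _) xB').
apply: subset_trans AB; apply: phi_homo.
apply/(subclass_denotes zA' (denotes_chk N A)).
by move=> o o' o'w; apply: zA; apply: fle_trans wv.
Qed.

End Tukey.
End Families.

(** * The ideal fin ⊗ fin *)

Section GroundFinFin.
Implicit Types (A B : set (nat * nat)) (p q r : finfin_forcing).

Lemma ground_fin_fin0 : ground_fin_fin set0.
Proof. exact: ground_fin_finW (sub0set _) (finfin_le_refl finfin_one). Qed.

Lemma ground_fin_fin_fst (I : set nat) : finite_set I ->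
  ground_fin_fin (fst @^-1` I).
Proof.
apply: sub_finite_set => n /=; apply: contra_notP => nI.
by apply: sub_finite_set (@finite_set0 nat) => m.
Qed.

Lemma ground_fin_fin_bigcup (T : Type) (I : set T) (F : T -> set (nat * nat)) :
  finite_set I -> (forall i, I i -> ground_fin_fin (F i)) ->
  ground_fin_fin (\bigcup_(i in I) F i).
Proof.
move=> finI finF; apply: sub_finite_set (bigcup_finite finI finF).
move=> n /=; apply: contra_notP => h.
apply: (@bigcup_finite _ _ _ (fun i => [set m | F i (n, m)])) => // i Ii.
by apply: contrapT => nfin; apply: h; exists i.
Qed.

Lemma infinite_nat_unbounded (I : set nat) n :
  ~ finite_set I -> exists2 m, n <= m & I m.
Proof.
move=> infI; apply: contrapT => h; apply: infI.
apply: sub_finite_set (finite_II n) => m Im /=; rewrite ltnNge.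
by apply/negP => nm; apply: h; exists m.
Qed.

Lemma infinite_range (k : nat -> nat) :
  {homo k : i j / i < j} -> ~ finite_set (range k).
Proof.
move=> k_homo; have kinj : injective k.
  move=> i j kij; case: (ltngtP i j) => // /k_homo; by rewrite kij ltnn.
rewrite (eq_finite_set (inj_card_eq _)); first exact: infinite_nat.
by move=> i j _ _ /kinj.
Qed.

(** For injective [k] this is the set whose column [k n] is that of [B n], all other columns being
    empty. *)
Definition diagonal (k : nat -> nat) (B : nat -> set (nat * nat)) :=
  [set z | exists2 n, z.1 = k n & B n z].

(** The fusion behind sigma-closure, rapidity and the cofinality of [square_of]. Each [B n] has
    infinite columns arbitrarily far to the right; picking one for every n gives infinitely many
    infinite columns. *)
Lemma diagonal_exists (B : nat -> set (nat * nat)) (f : nat -> nat) :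
  (forall n, ~ ground_fin_fin (B n)) ->
  exists k : nat -> nat, [/\ {homo k : i j / i < j}, forall n, f n <= k n &
    ~ ground_fin_fin (diagonal k B)].
Proof.
move=> infB.
have : forall nm : nat * nat, exists j, nm.2 <= j /\
    ~ finite_set [set m | B nm.1 (j, m)].
  move=> [n m]; have [j mj h] := infinite_nat_unbounded m (@infB n).
  by exists j.
case/choice=> g gP.
(* The second argument of [g] bounds the chosen column from below: [f n] gives the growth, and the
   successor of the previous column gives strict monotonicity. *)
pose k := fix k n :=
  if n is m.+1 then g (n, maxn (f n) (k m).+1) else g (0, f 0).
have k_homo : {homo k : i j / i < j}.
  apply: homo_ltn => [j i l|i]; first exact: ltn_trans.
  have [h _] := gP (i.+1, maxn (f i.+1) (k i).+1).
  by apply: leq_trans h; apply: leq_maxr.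
have kP n : f n <= k n /\ ~ finite_set [set m | B n (k n, m)].
  case: n => [|n]; first exact: gP.
  have [h h'] := gP (n.+1, maxn (f n.+1) (k n).+1); split=> //.
  by apply: leq_trans h; apply: leq_maxl.
exists k; split=> // [n|]; first by case: (kP n).
move=> fin; apply: (infinite_range k_homo); apply: sub_finite_set fin.
move=> _ [n _ <-] /= fin; case: (kP n) => _; apply.
by apply: sub_finite_set fin => m Bm; exists n.
Qed.

(** A point of the diagonal outside [B i] can only come from some [B n] with n < i, so it lies in
    one of finitely many columns. *)
Lemma diagonal_almost_sub (k : nat -> nat) (B : nat -> set (nat * nat)) i :
  (forall m n, m <= n -> B n `<=` B m) -> ground_fin_fin (diagonal k B `\` B i).
Proof.
move=> B_homo; apply: ground_fin_finW (ground_fin_fin_fst (I := k @` `I_i) _).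
  move=> z [[n zn Bz] nBz]; exists n => //=; rewrite ltnNge.
  by apply/negP => /B_homo /(_ z Bz).
exact/finite_image/finite_II.
Qed.

Definition positive A (infA : ~ ground_fin_fin A) : finfin_forcing :=
  exist _ A infA.

(** By [generic_represents] this says that [q] forces [A] into the generic filter. Unlike
    [finfin_le] it takes an arbitrary set, without a proof of positivity. *)
Definition below (q : finfin_forcing) A := ground_fin_fin (sval q `\` A).

Lemma below_mono q r A : fle r q -> below q A -> below r A.
Proof.
move=> rq qA; apply: ground_fin_finW (ground_fin_finU rq qA) => z [rz nA].
by have [qz|nq] := pselect (sval q z); [right|left].
Qed.

Lemma belowW q A B : A `<=` B -> below q A -> below q B.
Proof.
by move=> AB; apply: ground_fin_finW => z [qz nB]; split=> // /AB.
Qed.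

Lemma below_sub q A : sval q `<=` A -> below q A.
Proof.
by move=> qA; apply: ground_fin_finW ground_fin_fin0 => z [/qA].
Qed.

Lemma belowI q A B : below q A -> below q B -> below q (A `&` B).
Proof.
move=> qA qB; apply: ground_fin_finW (ground_fin_finU qA qB) => z [qz nAB].
by have [Az|nA] := pselect (A z); [right; split=> // Bz; apply: nAB|left].
Qed.

Lemma below_positive q A : below q A -> ~ ground_fin_fin A.
Proof.
move=> qA fA; apply: (svalP q).
apply: ground_fin_finW (ground_fin_finU qA fA) => z qz.
by have [Az|nA] := pselect (A z); [right|left].
Qed.

Lemma below_disjoint q A : below q A -> ~ below q (~` A).
Proof.
move=> qA /(belowI qA) /below_positive; apply.
by rewrite setICr; apply: ground_fin_fin0.
Qed.

(** Separativity: were [q] minus [A] positive, it would be a condition below [q], and a stronger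
    condition almost inside [A] would be almost empty. *)
Lemma below_dense q A : dense_below (below^~ A) q -> below q A.
Proof.
move=> qA; apply: contrapT => nqA.
pose r := positive nqA.
have [|s sr sA] := qA r; first by apply: below_sub => z [].
have : below s (sval r `&` A) by apply: belowI.
move/below_positive; apply; apply: ground_fin_finW ground_fin_fin0.
by move=> z [[_ nA] /nA].
Qed.

(** Shrink the condition to its part in [A] if that is positive; otherwise the condition is already
    almost disjoint from [A]. *)
Lemma below_decide q A : dense_below (fun r => below r A \/ below r (~` A)) q.
Proof.
move=> r _; have [fA|nA] := pselect (ground_fin_fin (sval r `&` A)).
  exists r; first exact: finfin_le_refl.
  by right; apply: ground_fin_finW fA => z [rz /contrapT Az].
exists (positive nA); first by apply: below_sub => z [].
by left; apply: below_sub => z [].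
Qed.

(** The order is inclusion modulo the ideal, so first pass to the finite intersections [B n], which
    really decrease and still almost contain [s n]. Their diagonal is a lower bound. *)
Lemma finfin_sigma_closed : sigma_closed finfin_forcing.
Proof.
move=> s s_decr.
pose B n := [set z | forall i, i <= n -> sval (s i) z].
have sB n : below (s n) (B n).
  elim: n => [|n IH].
    by apply: below_sub => z sz i; rewrite leqn0 => /eqP->.
  have snn : below (s n.+1) (sval (s n.+1)) by apply: below_sub.
  apply: (belowW _ (belowI (below_mono (s_decr n) IH) snn)).
  move=> z [Bz sz] i; rewrite leq_eqVlt => /orP[/eqP->//|]; exact: Bz.
have [k [_ _ infQ]] :=
  diagonal_exists (fun=> 0) (fun n => below_positive (sB n)).
exists (positive infQ) => n.
apply: (belowW (A := B n)); first by move=> z; apply.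
apply: diagonal_almost_sub => i j ij z Bz l li; apply: Bz; exact: leq_trans ij.
Qed.

End GroundFinFin.

(** * The product of the filter with itself and the two Tukey maps *)

Section Square.
Implicit Types (B D : set (nat * nat)) (C : set ((nat * nat) * (nat * nat)))
  (p q r s : finfin_forcing).

(** By [square_represents] this says that [q] forces [C] into the product. Density is asked for
    because [q] need not decide which sections of [C] are in the filter; the inner set grows as [r]
    gets stronger. *)
Definition below_square q C :=
  dense_below (fun r => below r [set x | below r [set y | C (x, y)]]) q.

Definition columns B n := count (fun i => `[< exists m, B (i, m) >]) (iota 0 n).

Lemma columnsS B n :
  columns B n.+1 = columns B n + `[< exists m, B (n, m) >].
Proof. by rewrite /columns -addn1 iotaD count_cat /= addn0 add0n. Qed.

Lemma columns_homo B : {homo columns B : m n / m <= n}.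
Proof.
apply: homo_leq => [//|j i k|i]; first exact: leq_trans.
by rewrite columnsS leq_addr.
Qed.

Lemma columns_sub B D n : B `<=` D -> columns B n <= columns D n.
Proof.
move=> BD; apply: sub_count => i /asboolP[m Bm]; apply/asboolP.
by exists m; apply: BD.
Qed.

Lemma columns_unbounded B N : ~ ground_fin_fin B -> exists n, N <= columns B n.
Proof.
move=> infB; elim: N => [|N [n Nn]]; first by exists 0.
have [i ni infi] := infinite_nat_unbounded n infB.
have [m [_ Bm]] : exists m, 0 <= m /\ B (i, m).
  by have [m m0 Bm] := infinite_nat_unbounded 0 infi; exists m.
exists i.+1; rewrite columnsS asboolT; last by exists m.
by rewrite addn1 ltnS (leq_trans Nn) // columns_homo.
Qed.

(** Nonempty columns of the diagonal have the form [k j], and those to the left of [k n] have j < n;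
    their list is compared with the image of [iota 0 n]. *)
Lemma columns_diagonal (k : nat -> nat) (E : nat -> set (nat * nat)) n :
  {homo k : i j / i < j} -> columns (diagonal k E) (k n) <= n.
Proof.
move=> k_homo; have k_mono : {mono k : i j / i <= j} by apply: leq_mono.
rewrite /columns -size_filter -[leqRHS](size_iota 0) -[leqRHS](size_map k).
apply: uniq_leq_size => [|i]; first by rewrite filter_uniq // iota_uniq.
rewrite mem_filter mem_iota /= add0n => /andP[/asboolP[m [j /= -> _]] ltjn].
apply: map_f; rewrite mem_iota /= add0n.
by rewrite ltnNge k_mono -ltnNge in ltjn.
Qed.

(** For fixed x and positive [B] the inequality excludes only finitely many columns of y, which
    keeps the set in the product. For fixed y it admits only finitely many x, which makes the map
    cofinal. *)
Definition square_of B : set ((nat * nat) * (nat * nat)) :=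
  [set z | [/\ B z.1, B z.2 & z.1.1 + z.1.2 <= columns B z.2.1]].

Lemma square_of_homo B D : B `<=` D -> square_of B `<=` square_of D.
Proof.
move=> BD z [B1 B2 le]; split; [exact: BD|exact: BD|].
by apply: leq_trans le _; apply: columns_sub.
Qed.

Lemma below_square_of q B : below q B -> below_square q (square_of B).
Proof.
move=> qB; apply: dense_intro => r rq; have rB := below_mono rq qB.
apply: (belowW _ rB) => x Bx.
have [n Nn] := columns_unbounded (x.1 + x.2) (below_positive rB).
have rn : below r (~` (fst @^-1` `I_n)).
  apply: ground_fin_finW (ground_fin_fin_fst (finite_II n)) => z [_].
  exact: contrapT.
apply: belowW (belowI rB rn) => y [By /negP]; rewrite -leqNgt => ny.
by split=> //=; apply: leq_trans Nn _; apply: columns_homo.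
Qed.

Lemma below_square_cofinal q C : below_square q C ->
  dense_below (fun r => exists2 B, below r B & square_of B `<=` C) q.
Proof.
move/dense_bind; apply=> s _; set D := [set x | _] => sD r rs.
pose I n := [set x | D x /\ x.1 + x.2 <= n].
(* Only finitely many x lie in [I n], so meeting all their sections costs an element of the ideal
   and leaves [E n] positive. *)
pose E n := (sval r `&` D) `&` [set y | forall x, I n x -> C (x, y)].
have rE n : below r (E n).
  apply: belowI.
    exact: belowI (below_sub (@subset_refl _ _)) (below_mono rs sD).
  have finI : finite_set (I n).
    apply: sub_finite_set (finite_setX (finite_II n.+1) (finite_II n.+1)).
    move=> x [_ le]; split=> /=; rewrite ltnS.
      by apply: leq_trans le; apply: leq_addr.
    by apply: leq_trans le; apply: leq_addl.
  have finC x : I n x -> ground_fin_fin (sval r `\` [set y | C (x, y)]).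
    by move=> [Dx _]; apply: below_mono rs Dx.
  apply: ground_fin_finW (ground_fin_fin_bigcup finI finC) => y [ry].
  by move/existsNP => [x /not_implyP[Ix nC]]; exists x.
have [k [k_homo _ infB]] :=
  diagonal_exists (fun=> 0) (fun n => below_positive (rE n)).
exists (positive infB); first by apply: below_sub => y [n _ [[]]].
exists (diagonal k E); first by apply: below_sub.
(* If y lies in column [k n], the inequality and [columns_diagonal] bound the sum of the coordinates
   of x by n; so x is in [I n], and y was chosen in its section. *)
move=> [x y] [/= [m _ [[_ Dx] _]] [n -> [_ Cy]] le]; apply: Cy; split=> //.
exact: leq_trans le (columns_diagonal E n k_homo).
Qed.

Definition proj_of C := [set x | exists y, C (x, y)].

Lemma proj_of_homo C C' : C `<=` C' -> proj_of C `<=` proj_of C'.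
Proof. by move=> CC' x [y Cxy]; exists y; apply: CC'. Qed.

(** A section forced into the filter is positive, hence nonempty. *)
Lemma below_proj_of q C : below_square q C -> below q (proj_of C).
Proof.
move=> qC; apply: below_dense; apply: (dense_imply qC) => r _.
apply: belowW => x rCx; apply: contrapT => nx; apply: (below_positive rCx).
by apply: ground_fin_finW ground_fin_fin0 => y Cxy; apply: nx; exists y.
Qed.

(** The witness is the cylinder over [B]: its sections at points of [B] are everything, and it
    projects into [B]. *)
Lemma below_proj_of_cofinal q B : below q B ->
  dense_below (fun r => exists2 C, below_square r C & proj_of C `<=` B) q.
Proof.
move=> qB; apply: dense_intro => r rq; exists (fst @^-1` B).
  apply: dense_intro => s sr; have sB := below_mono (fle_trans sr rq) qB.
  by apply: belowW (sB) => x Bx; apply: below_sub.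
by move=> x [].
Qed.

End Square.

(** * The generic filter *)

Section GenericFilter.
Implicit Types (X Y x y f : name finfin_forcing) (p q r s : finfin_forcing).

Notation G := (elts generic_name).

(** If [q] is almost inside [A], then [A] is positive, so it is itself a condition above [q] and
    indexes a branch of the name. The branches [check_rel] are convertible with [chk rel_naming]. *)
Lemma generic_represents : represents rel_naming G below.
Proof.
move=> X A q XA; split=> [XG|qA].
  apply: below_dense; apply: (dense_imply XG) => r rq [B rB e].
  suff -> : A = sval B by [].
  apply: denotes_inj (denotes_mono rq XA) _; exact/denotes_feq.
apply: dense_intro => r rq; exists (positive (below_positive qA)).
  exact: below_mono rq qA.
by apply/(denotes_feq rel_naming)/(denotes_mono rq XA).
Qed.

Lemma generic_regular X : regular (G X).
Proof. exact: regular_fmem. Qed.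

Lemma generic_subclass X p : (p ⊩ G X) -> p ⊩ subclass (elts X) omega2.
Proof.
move=> XG; apply: (dense_elim XG) => r rp [A rA e].
have XA : denotes rel_naming (elts X) (sval A) r by apply/denotes_feq.
exact/(subclass_denotes XA denotes_omega2).
Qed.

Definition class_in_generic C A p :=
  @class_in_denotes _ _ _ _ _ generic_regular generic_represents C A p.

Definition generic_elim X p := @represents_elim _ finfin_sigma_closed _ _ _ _ _
  generic_regular generic_represents (@denotes_omega2 _) generic_subclass X p.

Lemma generic_is_ultrafilter p : p ⊩ is_ultrafilter omega2 G.
Proof.
apply: (is_ultrafilter_represents finfin_sigma_closed generic_regular
  generic_represents (@denotes_omega2 _) generic_subclass).
- by move=> q; apply: below_sub.
- by move=> q /below_positive; apply; apply: ground_fin_fin0.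
- exact: belowI.
- exact: belowW.
- exact: below_decide.
Qed.

Lemma fin_fin_represents :
  represents rel_naming fin_fin (fun (_ : finfin_forcing) => ground_fin_fin).
Proof. by move=> X A q; apply: fin_fin_denotes finfin_sigma_closed _ _ _. Qed.

Lemma fin_fin_regular X : regular (@fin_fin finfin_forcing X).
Proof. by apply: regular_fand. Qed.

Lemma fin_fin_dual p : p ⊩ subclass fin_fin (dual omega2 G).
Proof.
move=> X q qp [Xsub Xfin]; split=> // r rq XG.
have /dense_ex[s sr [A XA sA]] := generic_elim XG.
apply: (below_positive sA); apply: (fin_fin_represents XA).1.
apply: (@forces_mono _ _ (fin_fin_regular X) _ _ (fle_trans sr rq)).
by split.
Qed.

Lemma omegac_num n p : p ⊩ omegac (num n).
Proof. exact/(denotes_nm denotes_omegac (fle_refl p) (feq_refl _ p)). Qed.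

Lemma generic_pseudo_intersection p :
  p ⊩ pseudo_intersection_property fin_fin G.
Proof.
move=> f q qp ffun.
pose D n r :=
  exists A, (r ⊩ opair (num n) (chk rel_naming A) ∈ f) /\ below r A.
have : dense_below (fun r => forall n, D n r) q.
  apply: (sigma_distributive finfin_sigma_closed) => [n r s sr [A [nAf rA]]|n].
    by exists A; split; [apply: fmem_mono nAf | apply: below_mono rA].
  apply: (dense_bind (is_fun_val ffun (fle_refl q) (@omegac_num n q))) => r rq.
  move=> [X [XG nXf _]].
  apply: (dense_imply (generic_elim XG)) => s sr [A XA sA].
  exists A; split=> //; apply: fmem_eql (fmem_mono sr nXf).
  by apply: opair_congr; [apply: feq_refl | apply/denotes_feq].
move/dense_bind; apply=> r rq /choice[A AP].
(* The condition [r] decides every term [A n] and is almost contained in it, so the set [r] itself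
   is the pseudo-intersection; any [s] below [r] puts it in the filter. *)
apply: dense_intro => s sr; exists (chk rel_naming (sval r)); split.
  exact: (generic_represents (denotes_chk _ _)).2.
move=> n X t ts nXf; have tr := fle_trans ts sr; have tq := fle_trans tr rq.
apply: (dense_elim (is_fun_num ffun tq nXf)) => v vt [i _ iXf].
have vr := fle_trans vt tr; have vq := fle_trans vr rq.
have XA : denotes rel_naming (elts X) (A i) v.
  apply/denotes_feq; apply: (is_fun_functional ffun vq (@omegac_num i v) iXf).
  exact: fmem_mono vr (AP i).1.
apply: (class_in_denotes fin_fin_regular fin_fin_represents
  (denotes_diffc (denotes_chk _ _) XA)).2.
exact: (AP i).2.
Qed.

Notation W := (proj_ultrafilter G).

Definition below_fst q (B : set nat) := below q (fst @^-1` B).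

Lemma proj_represents : represents num_naming W below_fst.
Proof.
move=> X B q XB; have XB' := denotes_proj_preimage XB.
split=> [[_ /(class_in_generic XB')] //|qB].
split; first exact/(subclass_denotes XB denotes_omegac).
exact/(class_in_generic XB').
Qed.

Lemma proj_regular X : regular (W X).
Proof. by apply: regular_fand. Qed.

Lemma proj_subclass X p : (p ⊩ W X) -> p ⊩ subclass (elts X) omegac.
Proof. by case. Qed.

Lemma proj_is_ultrafilter p : p ⊩ is_ultrafilter omegac W.
Proof.
apply: (is_ultrafilter_represents finfin_sigma_closed proj_regular
  proj_represents (@denotes_omegac _) proj_subclass).
- by move=> q; apply: below_sub.
- by move=> q /below_positive; apply; apply: ground_fin_fin0.
- by move=> q A B; apply: belowI.
- by move=> q A B AB; apply: belowW => z; apply: AB.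
- by move=> q A; apply: below_decide.
Qed.

(** Once the function is decided to be [h], thin the condition to columns [k n] with [h n <= k n].
    An element [k j] below [h i] then has j < i, so [range k] has at most i elements below [h i]. *)
Lemma generic_is_2rapid p : p ⊩ is_2rapid G.
Proof.
split; first exact: generic_is_ultrafilter.
split; first exact: fin_fin_dual.
split; first exact: proj_is_ultrafilter.
move=> f q qp [ffun finc].
pose D n r := exists i, r ⊩ opair (num n) (num i) ∈ f.
have : dense_below (fun r => forall n, D n r) q.
  apply: (sigma_distributive finfin_sigma_closed) => [n r s sr [i nif]|n].
    by exists i; apply: fmem_mono nif.
  apply: (dense_bind (is_fun_val ffun (fle_refl q) (@omegac_num n q))) => r rq.
  move=> [k [ko nkf _]].
  apply: (dense_imply (denotes_elim denotes_omegac (fle_refl r) ko)) => s sr.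
  move=> [i _ e]; exists i; apply: fmem_eql (fmem_mono sr nkf).
  by apply: opair_congr; first exact: feq_refl.
move/dense_bind; apply=> r rq /choice[h hP].
have h_homo : {homo h : i j / i <= j}.
  move=> i j; rewrite leq_eqVlt => /orP[/eqP->//|ij]; apply: ltnW.
  apply/(@num_memE finfin_forcing _ _ r).
  apply: (finc (num i) (num j) (num (h i)) (num (h j)) r rq).
  by split; [apply: num_mem | split; apply: hP].
move=> s sr.
(* The diagonal of the constant sequence [s] just selects columns of [s]. *)
have [k [k_homo hk infB]] := diagonal_exists h (fun=> svalP s).
have k_mono : {mono k : i j / i <= j} by apply: leq_mono.
pose t := positive infB.
have ts : fle t s by apply: below_sub => y [].
exists t => //; exists (chk num_naming (range k)); split.
  apply: (proj_represents (denotes_chk _ _)).2.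
  by apply: below_sub => y [n kn _]; exists n.
move=> n m u ut nmf.
have ur : fle u r := fle_trans ut (fle_trans ts sr); have uq := fle_trans ur rq.
apply: (dense_elim (is_fun_num ffun uq nmf)) => v vu [i ni imf].
have vr := fle_trans vu ur; have vq := fle_trans vr rq.
have mh : denotes num_naming (elts m) `I_(h i) v.
  apply: coextensive_trans (denotes_num (h i)); apply/feqP.
  apply: (is_fun_functional ffun vq (@omegac_num i v) imf).
  exact: fmem_mono vr (hP i).
(* [g] inverts [k] on its range, with default 0 elsewhere; it is the injection that witnesses the
   bound. *)
have /choice[g gP] : forall a, exists j, range k a -> k j = a.
  move=> a; have [[j _ kj]|nka] := pselect (range k a); by [exists j|exists 0].
apply: (card_le_denotes (g := g) (denotes_capc (denotes_chk _ _) mh) ni).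
  move=> a [ka /= ah]; rewrite ltnNge; apply/negP => /h_homo ig.
  by have := leq_trans ig (hk (g a)); rewrite gP // leqNgt ah.
by move=> a b [/gP ka _] [/gP kb _] e; rewrite -ka -kb e.
Qed.

Notation S2 := (prodc omega2 omega2).
Notation GG := (fubini_square omega2 G).

Definition square_naming : naming finfin_forcing ((nat * nat) * (nat * nat)) :=
  pair_naming rel_naming rel_naming.

Lemma denotes_square p : denotes square_naming S2 setT p.
Proof. by rewrite -setXTT; apply: denotes_prodc; apply: denotes_omega2. Qed.

(** In one direction, a set of x with large sections is densely decided as some B, and each point of
    B has its section forced into the filter. In the other, the class of such x has to be shown to
    be a set of the ground model, which takes countably many decisions. *)
Lemma square_represents : represents square_naming GG below_square.
Proof.
move=> X C q XC.
pose large x : sentence finfin_forcing :=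
  class_in (fun y => omega2 y ∧ opair x y ∈ X)%F G.
have largeE x z r : fle r q -> (r ⊩ x ≈ rel_naming z) ->
    (r ⊩ large x) <-> below r [set y | C (z, y)].
  move=> rq e; apply: class_in_generic.
  exact: (denotes_slice denotes_omega2 (denotes_mono rq XC) e).
split=> [[_ h]|qC].
  apply: (dense_bind h) => r rq [Y [YG /coextensiveP Ylarge]].
  apply: (dense_imply (generic_elim YG)) => s sr [B YB].
  have sq := fle_trans sr rq.
  apply: belowW => z Bz; apply/(largeE (rel_naming z)) => //.
    exact: feq_refl.
  apply: ((Ylarge _ s sr).1 _).2.
  exact/(denotes_nm YB (fle_refl s) (feq_refl _ s)).
split; first exact/(subclass_denotes XC (@denotes_square _)).
apply: (dense_bind qC) => r rq rC.
(* Deciding every section at once makes the class of x with large sections denote the set of z whose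
   section [s] forces into the filter. *)
have /dense_bind : dense_below (fun s => forall z, below s [set y | C (z, y)] \/
    below s (~` [set y | C (z, y)])) r.
  apply: (sigma_distributive finfin_sigma_closed) => [z s t ts|z].
    by case=> sz; [left|right]; apply: below_mono sz.
  exact: below_decide.
apply=> s sr decided; have sq := fle_trans sr rq.
apply: (class_in_generic (A := [set z | below s [set y | C (z, y)]]) _).2.
  apply: denotes_intro => [x t ts [xo _]|x z t ts e].
    apply: (dense_imply (denotes_elim denotes_omega2 (fle_refl t) xo)) => u _.
    by case=> z _ e; exists z.
  have lE := largeE x z t (fle_trans ts sq) e.
  split=> [[_ /lE tz]|sz] /=.
    case: (decided z) => // /(below_mono ts) /below_disjoint; case.
    by rewrite setCK.
  split; first exact/(denotes_nm denotes_omega2 (fle_refl t) e).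
  by apply/lE; apply: below_mono sz.
apply: belowW (below_mono sr rC) => z; exact: below_mono.
Qed.

Lemma square_regular X : regular (GG X).
Proof. by apply: regular_fand. Qed.

Lemma square_subclass X p : (p ⊩ GG X) -> p ⊩ subclass (elts X) S2.
Proof. by case. Qed.

(** The map of a reduction goes from the right-hand order to the left-hand one: [square_of] reduces
    the product to the filter, and [proj_of] the filter to the product. *)
Lemma generic_tukey p : p ⊩ tukey_equiv GG supset G supset.
Proof.
split.
  apply: (tukey_le_represents finfin_sigma_closed
    generic_regular generic_represents (@denotes_omega2 _) generic_subclass
    square_regular square_represents denotes_square square_subclass).
  - exact: below_square_of.
  - exact: square_of_homo.
  - exact: below_square_cofinal.
apply: (tukey_le_represents finfin_sigma_closed
  square_regular square_represents denotes_square square_subclass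
  generic_regular generic_represents (@denotes_omega2 _) generic_subclass).
- exact: below_proj_of.
- exact: proj_of_homo.
- exact: below_proj_of_cofinal.
Qed.

End GenericFilter.

Theorem theorem2p9 (p : finfin_forcing) :
  p ⊩ is_ultrafilter omega2 (elts generic_name) ∧
      subclass fin_fin (dual omega2 (elts generic_name)) ∧
      pseudo_intersection_property fin_fin (elts generic_name) ∧
      is_2rapid (elts generic_name) ∧
      tukey_equiv (fubini_square omega2 (elts generic_name)) supset
                  (elts generic_name) supset.
Proof.
split; first exact: generic_is_ultrafilter.
split; first exact: fin_fin_dual.
split; first exact: generic_pseudo_intersection.
by split; [apply: generic_is_2rapid | apply: generic_tukey].
Qed.
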